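(* Let $B\colon\mathcal C\to\mathcal C$ be a bimonad on a monoidal category $\mathcal C$, let $\mathcal M$ be a right module category over $\mathcal C$, and let $K,C\colon\mathcal M\to\mathcal M$ be two comodule monads over $B$. There is a bijective correspondence between morphisms of comodule monads $f\colon K\to C$ and strict module functors $F\colon\mathcal M^C\to\mathcal M^K$ (of right $\mathcal C^B$-module categories) such that $U^KF=U^C$, where $U^K\colon\mathcal M^K\to\mathcal M$ and $U^C\colon\mathcal M^C\to\mathcal M$ are the forgetful functors.
   Context: Monoidal categories and module categories are strict. A right module category is a category $\mathcal M$ with a functor $\triangleleft\colon\mathcal M\times\mathcal C\to\mathcal M$, strictly associative and unital. A bimonad on $\mathcal C$ is a monad $(B,\mu,\eta)$ with an oplax monoidal structure $\Delta_{X,Y}\colon B(X\otimes Y)\to B(X)\otimes B(Y)$, $\varepsilon\colon B(1)\to1$ such that $\mu,\eta$ are oplax monoidal natural transformations. Its category of modules (Eilenberg–Moore category) $\mathcal C^B$ is monoidal via $(X,\vartheta_X)\otimes(Y,\vartheta_Y)=(X\otimes Y,(\vartheta_X\otimes\vartheta_Y)\Delta_{X,Y})$. A comodule monad over $B$ on $\mathcal M$ is a monad $(K,\mu^{(K)},\eta^{(K)})$ on $\mathcal M$ together with a natural transformation $\delta^{(K)}_{M,X}\colon K(M\triangleleft X)\to K(M)\triangleleft B(X)$ such that: $(\mathrm{id}\triangleleft\Delta_{X,Y})\delta^{(K)}_{M,X\otimes Y}=(\delta^{(K)}_{M,X}\triangleleft\mathrm{id}_{B(Y)})\delta^{(K)}_{M\triangleleft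 X,Y}$; $(\mathrm{id}\triangleleft\varepsilon)\delta^{(K)}_{M,1}=\mathrm{id}_{K(M)}$; $\delta^{(K)}_{M,X}\mu^{(K)}_{M\triangleleft X}=(\mu^{(K)}_M\triangleleft\mu_X)\delta^{(K)}_{K(M),B(X)}K(\delta^{(K)}_{M,X})$; $\delta^{(K)}_{M,X}\eta^{(K)}_{M\triangleleft X}=\eta^{(K)}_M\triangleleft\eta_X$. A morphism of comodule monads $f\colon K\to C$ is a morphism of monads with $\delta^{(C)}_{M,X}f_{M\triangleleft X}=(f_M\triangleleft\mathrm{id}_{B(X)})\delta^{(K)}_{M,X}$. The category of modules $\mathcal M^K$ is a right module category over $\mathcal C^B$ via $(M,\vartheta_M)\triangleleft(X,\vartheta_X)=(M\triangleleft X,(\vartheta_M\triangleleft\vartheta_X)\delta^{(K)}_{M,X})$. A module functor $F$ is strict if $F(M\triangleleft X)=F(M)\triangleleft F$-image with identity structure morphism, i.e. $F(M\triangleleft X)=F(M)\triangleleft X$ naturally with the coherence isomorphism being the identity. *)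

(* Defs.v *)
From mathcomp Require Import ssreflect ssrfun ssrbool.
From Stdlib Require Import ProofIrrelevance FunctionalExtensionality.

Set Implicit Arguments.
Unset Strict Implicit.
Unset Printing Implicit Defensive.

#[local] Obligation Tactic := idtac.

Declare Scope cat_scope.
Delimit Scope cat_scope with cat.
Local Open Scope cat_scope.

Reserved Notation "g ∘ f" (at level 40, left associativity).
Reserved Notation "f ≡ g" (at level 70, no associativity).
Reserved Notation "X ⊗ Y" (at level 39, left associativity).
Reserved Notation "f ⊗m g" (at level 39, left associativity).
Reserved Notation "X ◁ Y" (at level 39, left associativity).
Reserved Notation "f ◁m g" (at level 39, left associativity).

Record category := Category {
  ob :> Type;
  hom : ob -> ob -> Type;
  idm : forall X, hom X X;
  comp : forall X Y Z, hom Y Z -> hom X Y -> hom X Z;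
  comp_idl : forall X Y (f : hom X Y), comp (idm Y) f = f;
  comp_idr : forall X Y (f : hom X Y), comp f (idm X) = f;
  compA : forall X Y Z W (h : hom Z W) (g : hom Y Z) (f : hom X Y),
    comp h (comp g f) = comp (comp h g) f
}.
Arguments hom {_} _ _.
Arguments idm {_} _.
Arguments comp {_ X Y Z} _ _.

Notation "g ∘ f" := (comp g f) : cat_scope.

(** Equality of morphisms as arrows of a category: sources and targets are
    equal objects, and along these equalities the morphisms coincide.  In a
    strict monoidal category [X ⊗ (Y ⊗ Z)] and [(X ⊗ Y) ⊗ Z] are equal but not
    convertible, so equations passing silently from one to the other are
    written with [≡]. *)
Inductive arrow_eq (A : category) (X Y : A) (f : hom X Y) :
    forall X' Y' : A, hom X' Y' -> Prop :=
  arrow_refl : arrow_eq f f.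

Notation "f ≡ g" := (arrow_eq f g) : cat_scope.

Record functor (A B : category) := Functor {
  fobj :> A -> B;
  fmap : forall X Y : A, hom X Y -> hom (fobj X) (fobj Y);
  fmap_id : forall X : A, fmap (idm X) = idm (fobj X);
  fmap_comp : forall (X Y Z : A) (g : hom Y Z) (f : hom X Y),
    fmap (g ∘ f) = fmap g ∘ fmap f
}.
Arguments fmap {A B} _ {X Y} _.

Definition fid (A : category) : functor A A :=
  @Functor A A (fun X => X) (fun X Y f => f)
    (fun X => erefl) (fun X Y Z g f => erefl).

Program Definition fcomp (A B D : category) (G : functor B D) (F : functor A B) :
    functor A D :=
  @Functor A D (fun X => G (F X)) (fun X Y f => fmap G (fmap F f)) _ _.
Next Obligation. by move=> A B D G F X; rewrite /= !fmap_id. Qed.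
Next Obligation. by move=> A B D G F X Y Z g f; rewrite /= !fmap_comp. Qed.

Program Definition prod_cat (A B : category) : category :=
  @Category (A * B)%type (fun p q => (hom p.1 q.1 * hom p.2 q.2)%type)
    (fun p => (idm p.1, idm p.2))
    (fun p q r g f => (g.1 ∘ f.1, g.2 ∘ f.2)) _ _ _.
Next Obligation. by move=> A B p q [f g] /=; rewrite /= !comp_idl. Qed.
Next Obligation. by move=> A B p q [f g] /=; rewrite /= !comp_idr. Qed.
Next Obligation. by move=> A B p q r s h g f /=; rewrite !compA. Qed.

Program Definition fprod (A B A' B' : category)
    (F : functor A A') (G : functor B B') :
    functor (prod_cat A B) (prod_cat A' B') :=
  @Functor (prod_cat A B) (prod_cat A' B') (fun p => (F p.1, G p.2))
    (fun p q f => (fmap F f.1, fmap G f.2)) _ _.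
Next Obligation. by move=> A B A' B' F G p; rewrite /= !fmap_id. Qed.
Next Obligation. by move=> A B A' B' F G p q r g f; rewrite /= !fmap_comp. Qed.

Definition bimap (A B D : category) (T : functor (prod_cat A B) D)
    (X X' : A) (Y Y' : B) (f : hom X X') (g : hom Y Y') :
    hom (T (X, Y)) (T (X', Y')) :=
  @fmap _ _ T (X, Y) (X', Y') (f, g).

Record nat_trans (A B : category) (F G : functor A B) := NatTrans {
  nt_app :> forall X : A, hom (F X) (G X);
  nt_nat : forall (X Y : A) (f : hom X Y),
    nt_app Y ∘ fmap F f = fmap G f ∘ nt_app X
}.

Definition is_iso (A : category) (X Y : A) (f : hom X Y) : Prop :=
  exists g : hom Y X, g ∘ f = idm X /\ f ∘ g = idm Y.

(** [tensorA_map], [tensor1l_map], ... together with the equations on objects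
    say that the two functors in question are equal. *)
Record monoidal_category := MonoidalCategory {
  mon_cat :> category;
  tensor : functor (prod_cat mon_cat mon_cat) mon_cat;
  tunit : mon_cat;
  tensorA_ob : forall X Y Z : mon_cat,
    tensor (tensor (X, Y), Z) = tensor (X, tensor (Y, Z));
  tensorA_map : forall (X X' Y Y' Z Z' : mon_cat)
      (f : hom X X') (g : hom Y Y') (h : hom Z Z'),
    bimap tensor (bimap tensor f g) h ≡ bimap tensor f (bimap tensor g h);
  tensor1l_ob : forall X : mon_cat, tensor (tunit, X) = X;
  tensor1l_map : forall (X X' : mon_cat) (f : hom X X'),
    bimap tensor (idm tunit) f ≡ f;
  tensor1r_ob : forall X : mon_cat, tensor (X, tunit) = X;
  tensor1r_map : forall (X X' : mon_cat) (f : hom X X'),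
    bimap tensor f (idm tunit) ≡ f
}.
Arguments tensor {_}.
Arguments tunit {_}.

Notation "X ⊗ Y" := (fobj tensor (X, Y)) : cat_scope.
Notation "f ⊗m g" := (bimap tensor f g) : cat_scope.

Record module_category (V : monoidal_category) := ModuleCategory {
  mod_cat :> category;
  act : functor (prod_cat mod_cat V) mod_cat;
  actA_ob : forall (M : mod_cat) (X Y : V),
    act (act (M, X), Y) = act (M, X ⊗ Y);
  actA_map : forall (M M' : mod_cat) (X X' Y Y' : V)
      (f : hom M M') (g : hom X X') (h : hom Y Y'),
    bimap act (bimap act f g) h ≡ bimap act f (g ⊗m h);
  act1_ob : forall M : mod_cat, act (M, tunit) = M;
  act1_map : forall (M M' : mod_cat) (f : hom M M'),
    bimap act f (idm (@tunit V)) ≡ f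
}.
Arguments act {V _}.

Notation "M ◁ X" := (fobj act (M, X)) : cat_scope.
Notation "f ◁m g" := (bimap act f g) : cat_scope.

Record module_functor (V : monoidal_category) (M N : module_category V) :=
  ModuleFunctor {
  mf_fun :> functor M N;
  mf_str : nat_trans (fcomp mf_fun (@act V M))
                     (fcomp (@act V N) (fprod mf_fun (fid V)));
  mf_str_iso : forall (m : M) (X : V), is_iso (mf_str (m, X));
  mf_strA : forall (m : M) (X Y : V),
    mf_str (m, X ⊗ Y)
      ≡ ((mf_str (m, X) : hom (mf_fun (m ◁ X)) (mf_fun m ◁ X)) ◁m idm Y)
          ∘ mf_str (m ◁ X, Y);
  mf_str1 : forall m : M, mf_str (m, tunit) ≡ idm (mf_fun m)
}.

(** [≡] also contains the equality of objects [F (m ◁ X) = F m ◁ X]; by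
    naturality of [mf_str], then [F (f ◁m g) ≡ F f ◁m g] as well. *)
Definition strict (V : monoidal_category) (M N : module_category V)
    (F : module_functor M N) : Prop :=
  forall (m : M) (X : V), mf_str F (m, X) ≡ idm (F m ◁ X).

Record monad (A : category) := Monad {
  mnd_fun :> functor A A;
  mnd_mul : nat_trans (fcomp mnd_fun mnd_fun) mnd_fun;
  mnd_unit : nat_trans (fid A) mnd_fun;
  mnd_mulA : forall X : A,
    mnd_mul X ∘ fmap mnd_fun (mnd_mul X) = mnd_mul X ∘ mnd_mul (mnd_fun X);
  mnd_unitl : forall X : A, mnd_mul X ∘ mnd_unit (mnd_fun X) = idm (mnd_fun X);
  mnd_unitr : forall X : A,
    mnd_mul X ∘ fmap mnd_fun (mnd_unit X) = idm (mnd_fun X)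
}.
Arguments mnd_mul {A} _.
Arguments mnd_unit {A} _.

Record bimonad (V : monoidal_category) := Bimonad {
  bim_monad :> monad V;
  bim_cotensor : nat_trans (fcomp bim_monad (@tensor V))
                           (fcomp (@tensor V) (fprod bim_monad bim_monad));
  bim_counit : hom (bim_monad tunit) tunit;
  bcotensor := fun X Y : V =>
    (bim_cotensor (X, Y) : hom (bim_monad (X ⊗ Y)) (bim_monad X ⊗ bim_monad Y));
  bim_coassoc : forall X Y Z : V,
    (bcotensor X Y ⊗m idm (bim_monad Z)) ∘ bcotensor (X ⊗ Y) Z
      ≡ (idm (bim_monad X) ⊗m bcotensor Y Z) ∘ bcotensor X (Y ⊗ Z);
  bim_counitl : forall X : V,
    (bim_counit ⊗m idm (bim_monad X)) ∘ bcotensor tunit X ≡ idm (bim_monad X);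
  bim_counitr : forall X : V,
    (idm (bim_monad X) ⊗m bim_counit) ∘ bcotensor X tunit ≡ idm (bim_monad X);
  (* [mnd_mul] and [mnd_unit] are oplax monoidal; the composite [B B] carries
     [Δ_{BX,BY} B(Δ_{X,Y})] and [ε B(ε)], the identity functor identities *)
  bim_mul_cotensor : forall X Y : V,
    bcotensor X Y ∘ mnd_mul bim_monad (X ⊗ Y)
      = (mnd_mul bim_monad X ⊗m mnd_mul bim_monad Y)
          ∘ (bcotensor (bim_monad X) (bim_monad Y)
               ∘ fmap bim_monad (bcotensor X Y));
  bim_mul_counit :
    bim_counit ∘ mnd_mul bim_monad tunit
      = bim_counit ∘ fmap bim_monad bim_counit;
  bim_unit_cotensor : forall X Y : V,
    bcotensor X Y ∘ mnd_unit bim_monad (X ⊗ Y)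
      = mnd_unit bim_monad X ⊗m mnd_unit bim_monad Y;
  bim_unit_counit : bim_counit ∘ mnd_unit bim_monad tunit = idm tunit
}.

Record comodule_monad (V : monoidal_category) (B : bimonad V)
    (M : module_category V) := ComoduleMonad {
  com_monad :> monad M;
  com_coact : nat_trans (fcomp com_monad (@act V M))
                        (fcomp (@act V M) (fprod com_monad B));
  coact := fun (m : M) (X : V) =>
    (com_coact (m, X) : hom (com_monad (m ◁ X)) (com_monad m ◁ B X));
  com_coassoc : forall (m : M) (X Y : V),
    (idm (com_monad m) ◁m bcotensor B X Y) ∘ coact m (X ⊗ Y)
      ≡ (coact m X ◁m idm (B Y)) ∘ coact (m ◁ X) Y;
  com_counit : forall m : M,
    (idm (com_monad m) ◁m bim_counit B) ∘ coact m tunit ≡ idm (com_monad m);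
  com_mul_coact : forall (m : M) (X : V),
    coact m X ∘ mnd_mul com_monad (m ◁ X)
      = (mnd_mul com_monad m ◁m mnd_mul B X)
          ∘ (coact (com_monad m) (B X) ∘ fmap com_monad (coact m X));
  com_unit_coact : forall (m : M) (X : V),
    coact m X ∘ mnd_unit com_monad (m ◁ X)
      = mnd_unit com_monad m ◁m mnd_unit B X
}.

Record comodule_monad_mor (V : monoidal_category) (B : bimonad V)
    (M : module_category V) (K C : comodule_monad B M) := ComoduleMonadMor {
  cmm_nt :> nat_trans K C;
  cmm_mul : forall m : M,
    cmm_nt m ∘ mnd_mul K m
      = mnd_mul C m ∘ (fmap C (cmm_nt m) ∘ cmm_nt (K m));
  cmm_unit : forall m : M, cmm_nt m ∘ mnd_unit K m = mnd_unit C m;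
  cmm_coact : forall (m : M) (X : V),
    coact C m X ∘ cmm_nt (m ◁ X) = (cmm_nt m ◁m idm (B X)) ∘ coact K m X
}.

Section EilenbergMoore.
Variables (A : category) (T : monad A).

Record algebra := Algebra {
  alg_car :> A;
  alg_act : hom (T alg_car) alg_car;
  alg_mul : alg_act ∘ mnd_mul T alg_car = alg_act ∘ fmap T alg_act;
  alg_unit : alg_act ∘ mnd_unit T alg_car = idm alg_car
}.

Record algebra_hom (a b : algebra) := AlgebraHom {
  alg_hom :> hom (alg_car a) (alg_car b);
  alg_hom_act : alg_hom ∘ alg_act a = alg_act b ∘ fmap T alg_hom
}.

Lemma algebra_hom_ext (a b : algebra) (f g : algebra_hom a b) :
  alg_hom f = alg_hom g -> f = g.
Proof.
case: f g => [f pf] [g pg] /= e; rewrite e in pf *.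
by rewrite (proof_irrelevance _ pf pg).
Qed.

Program Definition alg_id (a : algebra) : algebra_hom a a :=
  @AlgebraHom a a (idm _) _.
Next Obligation. by move=> a; rewrite /= fmap_id comp_idl comp_idr. Qed.

Program Definition alg_comp (a b c : algebra)
    (g : algebra_hom b c) (f : algebra_hom a b) : algebra_hom a c :=
  @AlgebraHom a c (alg_hom g ∘ alg_hom f) _.
Next Obligation.
by move=> a b c g f; rewrite /= fmap_comp -compA alg_hom_act !compA alg_hom_act.
Qed.

Program Definition em_cat : category :=
  @Category algebra algebra_hom alg_id alg_comp _ _ _.
Next Obligation. by move=> a b f; apply: algebra_hom_ext; apply: comp_idl. Qed.
Next Obligation. by move=> a b f; apply: algebra_hom_ext; apply: comp_idr. Qed.
Next Obligation.
by move=> a b c d h g f; apply: algebra_hom_ext; apply: compA.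
Qed.

Definition em_forget : functor em_cat A :=
  @Functor em_cat A alg_car (fun a b f => alg_hom f)
    (fun a => erefl) (fun a b c g f => erefl).

End EilenbergMoore.

Section ArrowEq.
Variable A : category.

Definition arrow := {X : A & {Y : A & hom X Y}}.
Definition to_arrow (X Y : A) (f : hom X Y) : arrow :=
  existT _ X (existT _ Y f).

Lemma arrow_eqE (X Y X' Y' : A) (f : hom X Y) (g : hom X' Y') :
  f ≡ g <-> to_arrow f = to_arrow g.
Proof.
split; first by case.
move=> e; change (f ≡ projT2 (projT2 (to_arrow g))).
by case: _ / e; exact: arrow_refl.
Qed.

Lemma arrow_eq_eq (X Y : A) (f g : hom X Y) : f ≡ g -> f = g.
Proof. move=> /arrow_eqE e; exact: (inj_pair2 _ _ _ _ _ (inj_pair2 _ _ _ _ _ e)). Qed.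

Lemma eq_arrow_eq (X Y : A) (f g : hom X Y) : f = g -> f ≡ g.
Proof. by move=> ->; exact: arrow_refl. Qed.

Lemma arrow_eq_sym (X Y X' Y' : A) (f : hom X Y) (g : hom X' Y') :
  f ≡ g -> g ≡ f.
Proof. by case; exact: arrow_refl. Qed.

Lemma arrow_eq_trans (X Y X' Y' X'' Y'' : A)
    (f : hom X Y) (g : hom X' Y') (h : hom X'' Y'') :
  f ≡ g -> g ≡ h -> f ≡ h.
Proof. by move=> fg; case. Qed.

Lemma arrow_eq_src (X Y X' Y' : A) (f : hom X Y) (g : hom X' Y') :
  f ≡ g -> X = X'.
Proof. by case. Qed.

Lemma arrow_eq_tgt (X Y X' Y' : A) (f : hom X Y) (g : hom X' Y') :
  f ≡ g -> Y = Y'.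
Proof. by case. Qed.

Lemma arrow_eq_comp (X Y Z X' Y' Z' : A) (g : hom Y Z) (f : hom X Y)
    (g' : hom Y' Z') (f' : hom X' Y') :
  g ≡ g' -> f ≡ f' -> g ∘ f ≡ g' ∘ f'.
Proof.
move=> eg ef.
have e1 := arrow_eq_src ef; have e2 := arrow_eq_tgt ef.
have e3 := arrow_eq_tgt eg; subst X' Y' Z'.
by rewrite (arrow_eq_eq eg) (arrow_eq_eq ef); exact: arrow_refl.
Qed.

Lemma arrow_eq_idm (X Y : A) : X = Y -> idm X ≡ idm Y.
Proof. by move=> ->; exact: arrow_refl. Qed.

End ArrowEq.

Lemma arrow_eq_bimap (A B D : category) (T : functor (prod_cat A B) D)
    (X X' X1 X1' : A) (Y Y' Y1 Y1' : B)
    (f : hom X X') (g : hom Y Y') (f1 : hom X1 X1') (g1 : hom Y1 Y1') :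
  f ≡ f1 -> g ≡ g1 -> bimap T f g ≡ bimap T f1 g1.
Proof. by case; case; exact: arrow_refl. Qed.

Lemma arrow_eq_fmap (A B : category) (F : functor A B)
    (X Y X' Y' : A) (f : hom X Y) (g : hom X' Y') :
  f ≡ g -> fmap F f ≡ fmap F g.
Proof. by case; exact: arrow_refl. Qed.

Lemma bimap_id (A B D : category) (T : functor (prod_cat A B) D)
    (X : A) (Y : B) : bimap T (idm X) (idm Y) = idm (T (X, Y)).
Proof. exact: (fmap_id T (X, Y)). Qed.

Lemma bimap_comp (A B D : category) (T : functor (prod_cat A B) D)
    (X X' X'' : A) (Y Y' Y'' : B) (f' : hom X' X'') (f : hom X X')
    (g' : hom Y' Y'') (g : hom Y Y') :
  bimap T (f' ∘ f) (g' ∘ g) = bimap T f' g' ∘ bimap T f g.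
Proof.
exact: (@fmap_comp _ _ T (X, Y) (X', Y') (X'', Y'') (f', g') (f, g)).
Qed.

Lemma algebra_ext (A : category) (T : monad A) (a b : algebra T) :
  alg_car a = alg_car b -> alg_act a ≡ alg_act b -> a = b.
Proof.
case: a b => [a ta pa qa] [b tb pb qb] /= e; subst b => /arrow_eq_eq e.
subst tb; by rewrite (proof_irrelevance _ pa pb) (proof_irrelevance _ qa qb).
Qed.

Lemma arrow_eq_em (A : category) (T : monad A) (a b a' b' : em_cat T)
    (f : hom a b) (g : hom a' b') :
  a = a' -> b = b' -> alg_hom f ≡ alg_hom g -> f ≡ g.
Proof.
move=> e e'; subst a' b' => /arrow_eq_eq e.
by rewrite (algebra_hom_ext e); exact: arrow_refl.
Qed.

Lemma bcotensor_nat (V : monoidal_category) (B : bimonad V) (X X' Y Y' : V)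
    (f : hom X X') (g : hom Y Y') :
  bcotensor B X' Y' ∘ fmap B (f ⊗m g)
    = (fmap B f ⊗m fmap B g) ∘ bcotensor B X Y.
Proof.
exact: (@nt_nat _ _ _ _ (bim_cotensor B) (X, Y) (X', Y') (f, g)).
Qed.

Lemma coact_nat (V : monoidal_category) (B : bimonad V) (M : module_category V)
    (K : comodule_monad B M) (m m' : M) (X X' : V)
    (f : hom m m') (g : hom X X') :
  coact K m' X' ∘ fmap K (f ◁m g) = (fmap K f ◁m fmap B g) ∘ coact K m X.
Proof.
exact: (@nt_nat _ _ _ _ (com_coact K) (m, X) (m', X') (f, g)).
Qed.

Section EMMonoidal.
Variables (V : monoidal_category) (B : bimonad V).

Program Definition em_tensor_ob (a b : algebra B) : algebra B :=
  @Algebra V B (alg_car a ⊗ alg_car b)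
    ((alg_act a ⊗m alg_act b) ∘ bcotensor B (alg_car a) (alg_car b)) _ _.
Next Obligation.
move=> a b; rewrite /= -compA bim_mul_cotensor fmap_comp.
rewrite [in RHS]compA -[in RHS](compA (_ ⊗m _) _ (fmap B _)) bcotensor_nat.
by rewrite !compA -!bimap_comp !alg_mul.
Qed.
Next Obligation.
by move=> a b; rewrite /= -compA bim_unit_cotensor -bimap_comp !alg_unit bimap_id.
Qed.

Program Definition em_tensor_map (a a' b b' : algebra B)
    (f : algebra_hom a a') (g : algebra_hom b b') :
    algebra_hom (em_tensor_ob a b) (em_tensor_ob a' b') :=
  @AlgebraHom V B (em_tensor_ob a b) (em_tensor_ob a' b')
    (alg_hom f ⊗m alg_hom g) _.
Next Obligation.
move=> a a' b b' f g; rewrite /= -compA bcotensor_nat !compA -!bimap_comp.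
by rewrite !alg_hom_act.
Qed.

Program Definition em_tensor :
    functor (prod_cat (em_cat B) (em_cat B)) (em_cat B) :=
  @Functor (prod_cat (em_cat B) (em_cat B)) (em_cat B)
    (fun p => em_tensor_ob p.1 p.2) (fun p q f => em_tensor_map f.1 f.2) _ _.
Next Obligation.
by move=> [a b]; apply: algebra_hom_ext; rewrite /= bimap_id.
Qed.
Next Obligation.
by move=> p q r g f; apply: algebra_hom_ext; rewrite /= bimap_comp.
Qed.

Definition em_unit : algebra B :=
  @Algebra V B tunit (bim_counit B) (bim_mul_counit B) (bim_unit_counit B).

Lemma em_tensorA (a b c : algebra B) :
  em_tensor_ob (em_tensor_ob a b) c = em_tensor_ob a (em_tensor_ob b c).
Proof.
apply: algebra_ext => /=; first exact: tensorA_ob.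
rewrite -[alg_act c in X in X ≡ _]comp_idr.
rewrite -[alg_act a in X in _ ≡ X]comp_idr !bimap_comp -!compA.
by apply: arrow_eq_comp; [exact: tensorA_map | exact: bim_coassoc].
Qed.

Lemma em_tensor1l (a : algebra B) : em_tensor_ob em_unit a = a.
Proof.
apply: algebra_ext => /=; first exact: tensor1l_ob.
rewrite -[bim_counit B]comp_idl -[alg_act a in X in X ≡ _]comp_idr.
rewrite bimap_comp -compA -[alg_act a in X in _ ≡ X]comp_idr.
by apply: arrow_eq_comp; [exact: tensor1l_map | exact: bim_counitl].
Qed.

Lemma em_tensor1r (a : algebra B) : em_tensor_ob a em_unit = a.
Proof.
apply: algebra_ext => /=; first exact: tensor1r_ob.
rewrite -[bim_counit B]comp_idl -[alg_act a in X in X ≡ _]comp_idr.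
rewrite bimap_comp -compA -[alg_act a in X in _ ≡ X]comp_idr.
by apply: arrow_eq_comp; [exact: tensor1r_map | exact: bim_counitr].
Qed.

Program Definition em_monoidal : monoidal_category :=
  @MonoidalCategory (em_cat B) em_tensor em_unit em_tensorA _ em_tensor1l _
    em_tensor1r _.
Next Obligation.
move=> *; apply: arrow_eq_em; [exact: em_tensorA.. | exact: tensorA_map].
Qed.
Next Obligation.
move=> *; apply: arrow_eq_em; [exact: em_tensor1l.. | exact: tensor1l_map].
Qed.
Next Obligation.
move=> *; apply: arrow_eq_em; [exact: em_tensor1r.. | exact: tensor1r_map].
Qed.

End EMMonoidal.

Section EMModule.
Variables (V : monoidal_category) (B : bimonad V) (M : module_category V).
Variable K : comodule_monad B M.

Program Definition em_act_ob (a : algebra K) (b : algebra B) : algebra K :=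
  @Algebra M K (alg_car a ◁ alg_car b)
    ((alg_act a ◁m alg_act b) ∘ coact K (alg_car a) (alg_car b)) _ _.
Next Obligation.
move=> a b; rewrite /= -compA com_mul_coact fmap_comp.
rewrite [in RHS]compA -[in RHS](compA (_ ◁m _) _ (fmap K _)) coact_nat.
by rewrite !compA -!bimap_comp !alg_mul.
Qed.
Next Obligation.
by move=> a b; rewrite /= -compA com_unit_coact -bimap_comp !alg_unit bimap_id.
Qed.

Program Definition em_act_map (a a' : algebra K) (b b' : algebra B)
    (f : algebra_hom a a') (g : algebra_hom b b') :
    algebra_hom (em_act_ob a b) (em_act_ob a' b') :=
  @AlgebraHom M K (em_act_ob a b) (em_act_ob a' b')
    (alg_hom f ◁m alg_hom g) _.
Next Obligation.
move=> a a' b b' f g; rewrite /= -compA coact_nat !compA -!bimap_comp.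
by rewrite !alg_hom_act.
Qed.

Program Definition em_act :
    functor (prod_cat (em_cat K) (em_monoidal B)) (em_cat K) :=
  @Functor (prod_cat (em_cat K) (em_monoidal B)) (em_cat K)
    (fun p => em_act_ob p.1 p.2) (fun p q f => em_act_map f.1 f.2) _ _.
Next Obligation.
by move=> [a b]; apply: algebra_hom_ext; rewrite /= bimap_id.
Qed.
Next Obligation.
by move=> p q r g f; apply: algebra_hom_ext; rewrite /= bimap_comp.
Qed.

Lemma em_actA (a : algebra K) (b c : algebra B) :
  em_act_ob (em_act_ob a b) c = em_act_ob a (em_tensor_ob b c).
Proof.
apply: algebra_ext => /=; first exact: actA_ob.
rewrite -[alg_act c in X in X ≡ _]comp_idr.
rewrite -[alg_act a in X in _ ≡ X]comp_idr !bimap_comp -!compA.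
apply: arrow_eq_comp; first exact: actA_map.
by apply: arrow_eq_sym; exact: com_coassoc.
Qed.

Lemma em_act1 (a : algebra K) : em_act_ob a (em_unit B) = a.
Proof.
apply: algebra_ext => /=; first exact: act1_ob.
rewrite -[bim_counit B]comp_idl -[alg_act a in X in X ≡ _]comp_idr.
rewrite bimap_comp -compA -[alg_act a in X in _ ≡ X]comp_idr.
by apply: arrow_eq_comp; [exact: act1_map | exact: com_counit].
Qed.

Program Definition em_module : module_category (em_monoidal B) :=
  @ModuleCategory (em_monoidal B) (em_cat K) em_act em_actA _ em_act1 _.
Next Obligation.
move=> *; apply: arrow_eq_em; [exact: em_actA.. | exact: actA_map].
Qed.
Next Obligation.
move=> *; apply: arrow_eq_em; [exact: em_act1.. | exact: act1_map].
Qed.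

End EMModule.

Definition strict_over (V : monoidal_category) (B : bimonad V)
    (M : module_category V) (K C : comodule_monad B M) :=
  {F : module_functor (em_module C) (em_module K)
     | strict F /\ fcomp (em_forget K) F = em_forget C}.

(* Main.v *)
(** A morphism [f : K -> C] acts by restriction of scalars,
    [(a, θ) |-> (a, θ ∘ f_a)].  Conversely, a functor [F] over [M] equips each
    [C]-algebra [a] with a [K]-action [κ_a] on the same object, such that all
    [C]-algebra morphisms are [K]-linear, and [f_m] is recovered as
    [κ_{C m} ∘ K(η_m)] from the free algebra [C m].  Linearity of
    [θ : C a -> a] yields [κ_a = θ ∘ f_a].  For the coactions, the point is
    that [δ : C(m ◁ X) -> C m ◁ B X] is itself [C]-linear, from a free algebra
    to the module category action of [B X] on [C m]. *)

From mathcomp Require Import ssreflect ssrfun ssrbool.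
From Stdlib Require Import ProofIrrelevance FunctionalExtensionality.
Require Import Defs.

Set Implicit Arguments.
Unset Strict Implicit.
Unset Printing Implicit Defensive.

#[local] Obligation Tactic := idtac.

Local Open Scope cat_scope.

(** * Extensionality for functors, transformations and structured morphisms *)

Lemma functor_ext (A D : category) (F G : functor A D) :
  (forall X : A, F X = G X) ->
  (forall (X Y : A) (f : hom X Y), fmap F f ≡ fmap G f) -> F = G.
Proof.
case: F G => [Fo Fm Fi Fc] [Go Gm Gi Gc] /= eo em.
have eFG : Fo = Go by apply: functional_extensionality.
subst Go; have eM : Fm = Gm.
  apply: functional_extensionality_dep => X.
  apply: functional_extensionality_dep => Y.
  by apply: functional_extensionality_dep => f; apply: arrow_eq_eq.
subst Gm; by rewrite (proof_irrelevance _ Fi Gi) (proof_irrelevance _ Fc Gc).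
Qed.

Lemma functor_eq_fmap (A D : category) (F G : functor A D) (X Y : A)
    (f : hom X Y) : F = G -> fmap F f ≡ fmap G f.
Proof. by move=> ->; exact: arrow_refl. Qed.

Lemma nat_trans_ext (A D : category) (F G : functor A D) (s t : nat_trans F G) :
  (forall X : A, s X = t X) -> s = t.
Proof.
case: s t => [s ns] [t nt] /= e.
have est : s = t by apply: functional_extensionality_dep.
by subst t; rewrite (proof_irrelevance _ ns nt).
Qed.

Lemma comodule_monad_mor_ext (V : monoidal_category) (B : bimonad V)
    (M : module_category V) (K C : comodule_monad B M)
    (f g : comodule_monad_mor K C) : (forall m : M, f m = g m) -> f = g.
Proof.
case: f g => [f f1 f2 f3] [g g1 g2 g3] /= e.
have efg : f = g by apply: nat_trans_ext.
subst g; by rewrite (proof_irrelevance _ f1 g1) (proof_irrelevance _ f2 g2)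
  (proof_irrelevance _ f3 g3).
Qed.

(** Strictness makes every structure component an identity up to [≡], so the two structures agree
    componentwise; the other fields are propositions. *)
Lemma strict_module_functor_ext (V : monoidal_category)
    (M N : module_category V) (F G : module_functor M N) :
  strict F -> strict G -> mf_fun F = mf_fun G -> F = G.
Proof.
case: F G => [F s s1 s2 s3] [G t t1 t2 t3] sF sG /= e; subst G.
have est : s = t.
  apply: nat_trans_ext => -[m X]; apply: arrow_eq_eq.
  by apply: arrow_eq_trans (arrow_eq_sym (sG m X)); exact: (sF m X).
subst t; by rewrite (proof_irrelevance _ s1 t1) (proof_irrelevance _ s2 t2)
  (proof_irrelevance _ s3 t3).
Qed.

Lemma eq_alg_act (A : category) (T : monad A) (a b : algebra T) :
  a = b -> alg_act a ≡ alg_act b.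
Proof. by move=> ->; exact: arrow_refl. Qed.

Lemma arrow_eq_alg_hom (A : category) (T : monad A) (a b a' b' : em_cat T)
    (f : hom a b) (g : hom a' b') : f ≡ g -> alg_hom f ≡ alg_hom g.
Proof. by case; exact: arrow_refl. Qed.

(** * Free algebras *)

Definition free_alg (A : category) (T : monad A) (X : A) : algebra T :=
  @Algebra A T (T X) (mnd_mul T X) (esym (mnd_mulA T X)) (mnd_unitl T X).

Definition free_map (A : category) (T : monad A) (X Y : A) (f : hom X Y) :
    algebra_hom (free_alg T X) (free_alg T Y) :=
  @AlgebraHom A T (free_alg T X) (free_alg T Y) (fmap T f)
    (esym (nt_nat (mnd_mul T) f)).

(** The counit of the free-forgetful adjunction at [a]. *)
Definition alg_act_hom (A : category) (T : monad A) (a : algebra T) :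
    algebra_hom (free_alg T (alg_car a)) a :=
  @AlgebraHom A T (free_alg T (alg_car a)) a (alg_act a) (alg_mul a).

Section Correspondence.
Variables (V : monoidal_category) (B : bimonad V) (M : module_category V).
Variables K C : comodule_monad B M.

(** * From morphisms of comodule monads to strict module functors *)

Section Restriction.
Variable f : comodule_monad_mor K C.

Program Definition res_ob (a : algebra C) : algebra K :=
  @Algebra M K (alg_car a) (alg_act a ∘ f (alg_car a)) _ _.
Next Obligation.
move=> a; rewrite /= fmap_comp -compA cmm_mul !compA alg_mul.
rewrite -[in RHS](compA (alg_act a) (f _)) (nt_nat f) !compA.
by rewrite -!compA (nt_nat f).
Qed.
Next Obligation. by move=> a; rewrite /= -compA cmm_unit alg_unit. Qed.

Program Definition res_map (a b : algebra C) (h : algebra_hom a b) :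
    algebra_hom (res_ob a) (res_ob b) :=
  @AlgebraHom M K (res_ob a) (res_ob b) (alg_hom h) _.
Next Obligation.
by move=> a b h; rewrite /= compA alg_hom_act -!compA (nt_nat f).
Qed.

Program Definition res : functor (em_module C) (em_module K) :=
  @Functor (em_cat C) (em_cat K) res_ob (@res_map) _ _.
Next Obligation. by move=> a; apply: algebra_hom_ext. Qed.
Next Obligation. by move=> a b c g h; apply: algebra_hom_ext. Qed.

(** Compatibility of [f] with the coactions, [cmm_coact], is what makes restriction commute with the
    action on objects. *)
Lemma res_act (a : algebra C) (b : algebra B) :
  res_ob (em_act_ob a b) = em_act_ob (res_ob a) b.
Proof.
apply: algebra_ext => //=; apply: eq_arrow_eq.
by rewrite -compA cmm_coact compA -bimap_comp comp_idr.
Qed.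

(** Source and target are equal but not convertible algebras on the same object; lifting the
    identity of that object avoids a transport. *)
Program Definition res_str_app (p : prod_cat (em_module C) (em_monoidal B)) :
    algebra_hom (res_ob (em_act_ob p.1 p.2)) (em_act_ob (res_ob p.1) p.2) :=
  @AlgebraHom M K _ _ (idm (alg_car p.1 ◁ alg_car p.2)) _.
Next Obligation.
move=> [a b]; rewrite fmap_id comp_idl comp_idr.
by apply: arrow_eq_eq; exact: eq_alg_act (res_act a b).
Qed.

Program Definition res_str :
    nat_trans (fcomp res (@act _ (em_module C)))
      (fcomp (@act _ (em_module K)) (fprod res (fid (em_monoidal B)))) :=
  @NatTrans _ _ _ _ res_str_app _.
Next Obligation.
by move=> p q h; apply: algebra_hom_ext; rewrite /= comp_idl comp_idr.
Qed.

Lemma res_str_strict (a : em_module C) (b : em_monoidal B) :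
  res_str (a, b) ≡ idm (res a ◁ b).
Proof.
apply: arrow_eq_em => /=; [exact: res_act | by [] | exact: arrow_refl].
Qed.

Program Definition res_module : module_functor (em_module C) (em_module K) :=
  @ModuleFunctor _ _ _ res res_str _ _ _.
Next Obligation.
move=> a b.
(* Abstracting the component lets its source be rewritten to its target, after which it is an
   identity. *)
have := res_str_strict a b; move: (res_str (a, b)) => s h.
have e := arrow_eq_src h; move: s h => /=.
rewrite /= in e; rewrite e => s /arrow_eq_eq ->.
by exists (idm _); split; exact: comp_idl.
Qed.
Next Obligation.
move=> a b c; apply: arrow_eq_em => /=.
- by rewrite em_actA.
- by rewrite em_actA.
- by rewrite bimap_id comp_idl; apply: arrow_eq_idm; rewrite actA_ob.
Qed.
Next Obligation.
move=> a; apply: arrow_eq_em => /=.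
- by rewrite em_act1.
- by rewrite em_act1.
- by apply: arrow_eq_idm; exact: act1_ob.
Qed.

Lemma res_over : fcomp (em_forget K) res_module = em_forget C.
Proof. by apply: functor_ext => //= a b h; exact: arrow_refl. Qed.

Definition res_strict_over : strict_over K C :=
  exist _ res_module (conj res_str_strict res_over).

End Restriction.

(** On the free algebra [C m] the restricted action is [μ ∘ f (C m)]; precomposing with [K(η_m)]
    gives back [f m] by naturality and the unit law. *)
Lemma res_strict_over_inj : injective res_strict_over.
Proof.
move=> f g e.
apply: comodule_monad_mor_ext => m.
pose ev (F : strict_over K C) : algebra K :=
  mf_fun (proj1_sig F) (free_alg C m : em_module C).
have := eq_alg_act (f_equal ev e).
move=> /arrow_eq_eq /= /(f_equal (fun h => h ∘ fmap K (mnd_unit C m))).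
by rewrite -!compA !nt_nat !compA !mnd_unitr !comp_idl.
Qed.

(** * From strict module functors to morphisms of comodule monads *)

Section Reconstruction.
Variable F : module_functor (em_module C) (em_module K).
Hypothesis strictF : strict F.
Hypothesis overF : fcomp (em_forget K) F = em_forget C.

Lemma over_car (a : algebra C) : alg_car (F a : algebra K) = alg_car a.
Proof. exact: (f_equal (fun G => fobj G (a : em_module C)) overF). Qed.

Lemma over_hom (a b : algebra C) (h : algebra_hom a b) :
  alg_hom (@fmap _ _ F a b h : algebra_hom (F a : algebra K) (F b)) ≡ alg_hom h.
Proof. exact: (@functor_eq_fmap (em_module C) _ _ _ a b h overF). Qed.

(** The action κ of [F a], transported to the carrier of [a] so that it composes with morphisms of
    [M]. *)
Definition over_act (a : algebra C) : hom (K (alg_car a)) (alg_car a) :=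
  eq_rect _ (fun X => hom (K X) X) (alg_act (F a : algebra K)) _ (over_car a).

Lemma over_actE (a : algebra C) : over_act a ≡ alg_act (F a : algebra K).
Proof. by rewrite /over_act; case: _ / (over_car a); exact: arrow_refl. Qed.

Lemma over_act_mul (a : algebra C) :
  over_act a ∘ mnd_mul K (alg_car a) = over_act a ∘ fmap K (over_act a).
Proof.
rewrite /over_act; case: _ / (over_car a); exact: alg_mul.
Qed.

Lemma over_act_unit (a : algebra C) :
  over_act a ∘ mnd_unit K (alg_car a) = idm (alg_car a).
Proof.
rewrite /over_act; case: _ / (over_car a); exact: alg_unit.
Qed.

Lemma over_act_hom (a b : algebra C) (h : algebra_hom a b) :
  alg_hom h ∘ over_act a = over_act b ∘ fmap K (alg_hom h).
Proof.
apply: arrow_eq_eq.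
have eh := over_hom h; have eh' := arrow_eq_sym eh.
apply: arrow_eq_trans (arrow_eq_comp eh' (over_actE a)) _.
rewrite alg_hom_act; apply: arrow_eq_comp (arrow_eq_sym (over_actE b)) _.
exact: arrow_eq_fmap.
Qed.

Lemma over_act_act (a : algebra C) (b : algebra B) :
  over_act (em_act_ob a b)
    = (over_act a ◁m alg_act b) ∘ coact K (alg_car a) (alg_car b).
Proof.
apply: arrow_eq_eq; apply: arrow_eq_trans (over_actE _) _.
(* Strictness enters as the equality of algebras [F (a ◁ b) = F a ◁ b], the sources of the two
   arrows. *)
have e := arrow_eq_src (@strictF a b).
apply: arrow_eq_trans (eq_alg_act e) _ => /=.
apply: arrow_eq_comp.
  by apply: arrow_eq_bimap (arrow_refl _); exact: arrow_eq_sym (over_actE a).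
by rewrite over_car; exact: arrow_refl.
Qed.

Definition over_mor_app (m : M) : hom (K m) (C m) :=
  over_act (free_alg C m) ∘ fmap K (mnd_unit C m).

Lemma over_mor_nat (m n : M) (h : hom m n) :
  over_mor_app n ∘ fmap K h = fmap C h ∘ over_mor_app m.
Proof.
rewrite /over_mor_app compA (over_act_hom (free_map C h)) -!compA -!fmap_comp.
by rewrite /= -(nt_nat (mnd_unit C)).
Qed.

Definition over_mor_nt : nat_trans K C := NatTrans over_mor_nat.

Lemma over_act_mor (a : algebra C) :
  over_act a = alg_act a ∘ over_mor_nt (alg_car a).
Proof.
rewrite /= /over_mor_app compA (over_act_hom (alg_act_hom a)) -compA.
by rewrite -fmap_comp /= alg_unit fmap_id comp_idr.
Qed.

(** Linearity is the axiom [com_mul_coact]. The definition is transparent so that the underlying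
    morphism reduces to [coact C m X]. *)
Definition coact_hom (m : M) (X : V) :
    algebra_hom (free_alg C (m ◁ X)) (em_act_ob (free_alg C m) (free_alg B X)).
Proof.
exists (coact C m X); by rewrite /= com_mul_coact compA.
Defined.

Program Definition over_mor : comodule_monad_mor K C :=
  @ComoduleMonadMor _ _ _ K C over_mor_nt _ _ _.
Next Obligation.
(* With κ the action on the free algebra [C m], both sides become [κ ∘ K(κ) ∘ K(K(η))]. *)
move=> m; rewrite -(nt_nat over_mor_nt) compA.
rewrite -(over_act_mor (free_alg C m)) /= /over_mor_app -compA.
rewrite -(nt_nat (mnd_mul K)) compA over_act_mul /= fmap_comp.
by rewrite -!compA.
Qed.
Next Obligation.
move=> m; rewrite /= /over_mor_app -compA -(nt_nat (mnd_unit K)) compA.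
by rewrite (over_act_unit (free_alg C m)) comp_idl.
Qed.
Next Obligation.
(* Linearity moves δ inside [K], where it turns the unit into [η ◁ η]. Then κ on [C m ◁ B X] splits
   as [κ ◁ μ] after the coaction of [K], and [μ ∘ B(η)] cancels. *)
move=> m X; rewrite /= /over_mor_app compA (over_act_hom (coact_hom m X)).
rewrite -compA -fmap_comp /= com_unit_coact over_act_act -compA coact_nat.
by rewrite compA -bimap_comp /= mnd_unitr.
Qed.

(** The actions agree by [over_act_mor], and both functors keep underlying morphisms. *)
Lemma res_over_mor : mf_fun (res_module over_mor) = mf_fun F.
Proof.
have eo a : res_ob over_mor a = F a.
  apply: algebra_ext => /=; first by rewrite over_car.
  by rewrite -(over_act_mor a); exact: over_actE.
apply: functor_ext => // a b h; apply: arrow_eq_em; [exact: eo.. |].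
by apply: arrow_eq_sym; exact: over_hom.
Qed.

End Reconstruction.

Definition strict_over_mor (F : strict_over K C) : comodule_monad_mor K C :=
  over_mor (proj1 (proj2_sig F)) (proj2 (proj2_sig F)).

Lemma strict_over_morK : cancel strict_over_mor res_strict_over.
Proof.
case=> F sF; apply: subset_eq_compat.
apply: strict_module_functor_ext (res_over_mor _ _); last exact: (proj1 sF).
exact: res_str_strict.
Qed.

End Correspondence.

Theorem proposition6p25 (V : monoidal_category) (B : bimonad V)
    (M : module_category V) (K C : comodule_monad B M) :
  exists Phi : comodule_monad_mor K C -> strict_over K C,
    bijective Phi
    /\ forall (f : comodule_monad_mor K C) (a : algebra C),
         alg_act (fobj (mf_fun (proj1_sig (Phi f))) a)
           ≡ alg_act a ∘ f (alg_car a).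
Proof.
exists (@res_strict_over V B M K C); split; last first.
  by move=> f a; exact: arrow_refl.
exists (@strict_over_mor V B M K C); last exact: strict_over_morK.
(* An injective map with a right inverse has it as left inverse too. *)
by move=> f; apply: res_strict_over_inj; rewrite strict_over_morK.
Qed.
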